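(* Let $n\in\mathbb{N}$ and $L=\prod_{0\leq i\leq n}L_i$, where for each $i$ the linear order $L_i$ is either countable, or such that $\mathbb{R}\setminus\mathbb{Q}$ embeds into $L_i$ and $|G(L_i)|<2^{\aleph_0}$ ($\mathbb{R}\setminus\mathbb{Q}$ and $\mathbb{R}$ are instances of linear orders of the latter kind). If $L$ is uncountable, then $L$ is not strongly surjective.
   Context: All linear orders are assumed non-empty. An embedding is an order preserving injection; an epimorphism is an order preserving surjection. A linear order $M$ is strongly surjective if for every linear order $K$ that embeds into $M$ there is an epimorphism from $M$ onto $K$. For linear orders $L,K$, the product $LK$ is $\sum_{k\in K}L$, i.e. $K$ copies of $L$; $\prod_{0\leq i\leq n}L_i$ denotes the finite product $L_0L_1\cdots L_n$, so that two distinct tuples are compared at the largest index where they differ. A gap of a linear order $K$ is a non-empty initial segment $A\subseteq K$ with no maximum such that $K\setminus A$ is non-empty and has no minimum. $G(K)$ is the set of gaps of $K$. *)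

(* Defs.v *)
From HB Require Import structures.
From mathcomp Require Import all_boot all_order all_algebra.
From mathcomp Require Import all_classical reals.

Set Implicit Arguments.
Unset Strict Implicit.
Unset Printing Implicit Defensive.

Import Order.TTheory.
Local Open Scope classical_set_scope.
Local Open Scope card_scope.
Local Open Scope order_scope.

(* The induced order on a subset [A] of a linear order, so that e.g.
   [@irrational R], coerced to a type, is the linear order R \ Q. *)
HB.instance Definition _ (T : choiceType) (A : set T) :=
  SubChoice.copy (set_type A) {x : T | x \in A}.
HB.instance Definition _ d (T : orderType d) (A : set T) :=
  [SubChoice_isSubOrder of set_type A by <: with d].

(* L_0 L_1 ... L_(m-1) with L_0 L_1 = \sum_(k in L_1) L_0: the *largest* index
   where two tuples differ decides, the reverse of the usual convention for a
   lexicographic product. *)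
Definition colex_prod (m : nat) (d : 'I_m -> Order.disp_t)
    (L : forall i, orderType (d i)) : Type :=
  {dffun forall i, L i}.

Section ColexProd.
Variables (m : nat) (d : 'I_m -> Order.disp_t).
Variable L : forall i, orderType (d i).
Implicit Types x y z : colex_prod L.

HB.instance Definition _ := Choice.copy (colex_prod L) {dffun forall i, L i}.

Definition colex_lt x y : bool :=
  [exists i : 'I_m, (x i < y i) &&
    [forall j : 'I_m, (i < j)%N ==> (x j == y j)]].

Lemma colex_ltP x y :
  reflect (exists2 i : 'I_m, x i < y i &
             forall j : 'I_m, (i < j)%N -> x j = y j)
          (colex_lt x y).
Proof.
apply: (iffP existsP) => [[i /andP[lti /forallP H]]|[i lti H]]; exists i => //.
  by move=> j ij; apply/eqP; exact: (implyP (H j)).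
by rewrite lti; apply/forallP => j; apply/implyP => ij; apply/eqP/H.
Qed.

Lemma colex_lt_irr : irreflexive colex_lt.
Proof. by move=> x; case: colex_ltP => // -[i]; rewrite ltxx. Qed.

Lemma colex_lt_trans : transitive colex_lt.
Proof.
move=> y x z /colex_ltP[i xyi Hi] /colex_ltP[j yzj Hj]; apply/colex_ltP.
have [ij|ji|/val_inj ij] := ltngtP i j.
- exists j; first by rewrite Hi.
  by move=> k jk; rewrite Hi ?Hj// (ltn_trans ij).
- exists i; first by rewrite -Hj.
  by move=> k ik; rewrite Hi ?Hj// (ltn_trans ji).
- exists i; first by apply: lt_trans xyi _; rewrite ij.
  by move=> k ik; rewrite Hi ?Hj// -ij.
Qed.

HB.instance Definition _ :=
  Order.Lt_isPOrder.Build Order.default_display (colex_prod L)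
    colex_lt_irr colex_lt_trans.

Lemma colex_total : total (<=%O : rel (colex_prod L)).
Proof.
move=> x y; rewrite !le_eqVlt; have [//|xy] := eqVneq x y.
have /existsP[i0 i0P] : [exists i : 'I_m, x i != y i].
  apply: contraNT xy; rewrite negb_exists => /forallP H.
  by apply/eqP/ffunP => i; have := H i; rewrite negbK => /eqP.
case: (@arg_maxnP _ i0 (fun i => x i != y i) val i0P) => i xyi imax.
have Hi (j : 'I_m) : (i < j)%N -> x j = y j.
  move=> ij; apply/eqP; apply: contraTT ij => /imax /=.
  by rewrite -leqNgt.
have [lti|gti|/eqP] := ltgtP (x i) (y i); last by rewrite (negbTE xyi).
- by apply/orP; left; apply/colex_ltP; exists i.
- apply/orP; right; apply/orP; right; apply/colex_ltP.
  by exists i => // j ij; rewrite Hi.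
Qed.

HB.instance Definition _ :=
  Order.POrder_isTotal.Build Order.default_display (colex_prod L) colex_total.

End ColexProd.

Definition is_embedding d d' (K : orderType d) (M : orderType d')
    (f : K -> M) : Prop :=
  {homo f : x y / x <= y} /\ injective f.

Definition is_epimorphism d d' (M : orderType d) (K : orderType d')
    (f : M -> K) : Prop :=
  {homo f : x y / x <= y} /\ (forall k, exists x, f x = k).

Definition embeds d d' (K : orderType d) (M : orderType d') : Prop :=
  exists f : K -> M, is_embedding f.

Definition strongly_surjective d (M : orderType d) : Prop :=
  forall (d' : Order.disp_t) (K : orderType d'), [set: K] !=set0 ->
    embeds K M -> exists f : M -> K, is_epimorphism f.

Definition is_gap d (K : orderType d) (A : set K) : Prop :=
  [/\ A !=set0,
      (forall x y, x <= y -> A y -> A x),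
      ~ (exists2 x, A x & forall y, A y -> y <= x),
      (exists x, ~ A x)
    & ~ (exists2 x, ~ A x & forall y, ~ A y -> x <= y)].

Definition gaps d (K : orderType d) : set (set K) := [set A | is_gap A].
Arguments gaps {d} K.

Definition lt_continuum T (A : set T) : Prop :=
  A #<= [set: nat -> bool] /\ A #!= [set: nat -> bool].

Definition irrational_like (R : realType) d (K : orderType d) : Prop :=
  embeds (@irrational R) K /\ lt_continuum (gaps K).

(* Main.v *)
(* There is an uncountable set K of irrationals that plays the role of a
   Bernstein set: whenever the set Z of left limits of a sequence of reals has
   the size of the continuum, so has Z \ K.  A monotone map g from a linear
   order M to the reals with values in K and uncountable image X forces M to
   have continuum many gaps: a Cantor scheme in X yields continuum many left
   limits z of X outside K, and for all but countably many of them
   {k | g k < z} is a gap of M.  In a product, the slabs over the points of the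
   top factor L_j are convex, so a monotone map f to the reals is constant on
   all but countably many of them; apart from countably many slabs, the image of
   f is then the image of a monotone map on L_j.  By induction on the number of
   factors, every monotone map from L to the reals with values in K has a
   countable image.  So L does not map onto K, although K embeds into L through
   a factor into which the irrationals embed. *)
Require Import Defs.
From HB Require Import structures.
From mathcomp Require Import all_boot all_order all_algebra.
From mathcomp Require Import all_classical reals.
From mathcomp Require Import wochoice.

Set Implicit Arguments.
Unset Strict Implicit.
Unset Printing Implicit Defensive.

Import Order.TTheory GRing.Theory Num.Theory.
Local Open Scope order_scope.
Local Open Scope classical_set_scope.
Local Open Scope card_scope.

(** * Cardinal comparison, a short well-order, injective transversals *)

Lemma card_setT_leP T V (B : set V) :
  [set: T] #<= B <-> exists2 f : T -> V, injective f & forall t, B (f t).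
Proof.
split=> [/card_leP[f]|[f f_inj fB]].
  exists (fun t => val (f (SigSub (mem_set (Logic.I : [set: T] t))))).
    move=> s t /val_inj /(@inj _ _ _ f) st.
    have {}/(congr1 val) := st (mem_set Logic.I) (mem_set Logic.I).
    by [].
  by move=> t; exact: set_valP.
rewrite -(card_le_eql (inj_card_eq (in2W f_inj))).
by apply: subset_card_le => _ [t _ <-]; exact: fB.
Qed.

Lemma countable_rat T (A : set T) (q : T -> rat) :
  (forall x y, A x -> A y -> q x = q y -> x = y) -> countable A.
Proof.
move=> q_inj; apply: (@sub_countable _ _ _ [set: rat]) => //.
by apply/pcard_injP; exists q => x y; rewrite !inE; exact: q_inj.
Qed.

(* If some initial segment of a well-order is as large as [I], the order is pulled
   back along an injection of [I] into the least such segment. *)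
Lemma small_well_order (I : Type) : exists R : I -> I -> Prop,
  [/\ well_founded R, (forall x y, x <> y -> R x y \/ R y x) &
      forall i, ~ ([set: I] #<= [set j | R j i])].
Proof.
have [W Wwo] := well_ordering_principle {classic I}.
have min (A : set I) : A !=set0 ->
    exists2 x, A x & forall y, A y -> W x y.
  move=> [x Ax]; have [|m [[Am Wm] _]] := Wwo (mem A).
    by exists x; rewrite inE.
  by exists m => [|y Ay]; [rewrite inE in Am | apply: Wm; rewrite inE].
have Wtot x y : W x y \/ W y x.
  have [m [->|->] Wm] := min [set x; y] (ex_intro _ x (or_introl erefl)).
    by left; apply: Wm; right.
  by right; apply: Wm; left.
have Wanti (x y : I) : W x y -> W y x -> x = y.
  move=> xy yx; have Wr z : W z z by have [] := Wtot z z.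
  have [|m [_ mu]] := Wwo (mem [set x; y]); first by exists x; rewrite inE; left.
  transitivity m; first apply/esym; apply: mu; split; rewrite ?inE.
  - by left.
  - by move=> z; rewrite inE => -[]->.
  - by right.
  - by move=> z; rewrite inE => -[]->.
pose lt (x y : I) := W x y /\ x <> y.
have lt_wf : well_founded lt.
  apply: contrapT => /existsNP[x xN].
  have [m mN Wm] := min [set x | ~ Acc lt x] (ex_intro _ x xN).
  apply: mN; constructor => y [ym yNm]; apply: contrapT => /Wm my.
  exact: yNm (Wanti _ _ ym my).
have [f f_inj f_small] : exists2 f : I -> I, injective f &
    forall i, ~ ([set: I] #<= [set j | lt j (f i)]).
  pose big := [set i | [set: I] #<= [set j | lt j i]].
  have [/min[i0 /card_setT_leP[f f_inj fi0] i0_min]|] := pselect (big !=set0).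
    exists f => // i /i0_min i0f; have [fi0i] := fi0 i; apply.
    exact: Wanti fi0i i0f.
  by move=> bigN; exists id => // i Ii; apply: bigN; exists i.
exists (fun i j => lt (f i) (f j)); split.
- move=> x; move: {2}(f x) (erefl (f x)) => y; elim: (lt_wf y) x => {}y _ IH x xy.
  by constructor => w wx; apply: (IH (f w)) => //; rewrite -xy.
- move=> x y xy; have fxy : f x <> f y by move/f_inj.
  by have [?|?] := Wtot (f x) (f y); [left|right]; split=> // /esym.
- move=> i /card_setT_leP[g g_inj gi]; apply: (f_small i).
  by apply/card_setT_leP; exists (f \o g) => //; exact: inj_comp.
Qed.

(** Transfinite recursion along a well-order whose proper initial segments are all smaller than [I].
    At stage [i] some point of [S i] is still free: otherwise, sending each point of a copy of [I]
    in [S i] to the index that used it would inject [I] into the segment below [i]. *)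
Lemma injective_transversal (I V : Type) (S : I -> set V) :
  (forall i, [set: I] #<= S i) ->
  exists2 z : I -> V, injective z & forall i, S i (z i).
Proof.
move=> IS; have [R [Rwf Rtot R_small]] := small_well_order I.
have next i (rec : forall j, R j i -> V) :
    exists v, S i v /\ forall j (ji : R j i), rec j ji <> v.
  apply: contrapT => /forallNP none; apply: (R_small i).
  have /card_setT_leP[g g_inj gS] := IS i.
  have used k : exists j : {j | R j i}, rec (sval j) (proj2_sig j) = g k.
    apply: contrapT => /forallNP unused; apply: (none (g k)); split=> [|j ji];
      first exact: gS.
    exact: unused (exist _ j ji).
  have [h hE] := choice used.
  apply/card_setT_leP; exists (fun k => sval (h k)) => [k l|k]; last exact: svalP.
  by move=> /eq_sig_hprop kl; apply: g_inj; rewrite -!hE kl// => *;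
     exact: Prop_irrelevance.
pose F i rec := sval (cid (next i rec)).
pose z := Fix Rwf (fun=> V) F.
have zE i : z i = F i (fun j _ => z j).
  rewrite /z Fix_eq// => k r s rs; congr F.
  apply: functional_extensionality_dep => j.
  by apply: functional_extensionality_dep => ji; exact: rs.
have zP i := svalP (cid (next i (fun j _ => z j))).
have zR i j : R j i -> z j <> z i.
  by move=> ji; rewrite (zE i); have [_ /(_ _ ji)] := zP i.
exists z => [i j zij|i]; last by rewrite zE; have [] := zP i.
by apply: contrapT => /Rtot[] /zR; rewrite zij.
Qed.

(** * The cardinality of the continuum *)

Local Notation continuum := [set: nat -> bool].

Lemma continuum_uncountable : ~ countable continuum.
Proof.
move=> /card_setT_leP[f f_inj _].
(* Cantor's diagonal: evaluating [d] at its own code [f d] is contradictory. *)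
pose d n := `[< exists2 t, f t = n & t n = false >].
have [dd|/negP dd] := boolP (d (f d)).
  by have /asboolP[t /f_inj ->] := dd; rewrite dd.
by apply: (dd); apply/asboolP; exists d => //; apply/negP.
Qed.

Lemma predicates_le_continuum (C : countType) : [set: C -> bool] #<= continuum.
Proof.
apply/card_setT_leP; exists (fun t n => oapp t false (unpickle n)) => // s t st.
by apply: funext => c; have /(congr1 (@^~ (pickle c))) := st; rewrite pickleK.
Qed.

(** A real is determined by the rationals above it, so a triple is coded by a predicate on a
    countable type. *)
Lemma sequences_le_continuum (R : realType) :
  [set: (nat -> R) * (nat -> bool) * bool] #<= continuum.
Proof.
apply: card_le_trans (predicates_le_continuum (nat * rat + (nat + unit))%type).
apply/card_setT_leP; exists (fun x c => match c with
  | inl (n, q) => x.1.1 n < ratr q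
  | inr (inl n) => x.1.2 n
  | inr (inr _) => x.2 end) => // -[[s t] b] [[s' t'] b'] /= E.
have -> : b = b' by have /(congr1 (@^~ (inr (inr tt)))) := E.
have -> : t = t'.
  by apply: funext => n; have /(congr1 (@^~ (inr (inl n)))) := E.
suff -> : s = s' by [].
apply: funext => n; have {}E q := congr1 (@^~ (inl (n, q))) E.
have [/rat_in_itvoo[q]|/rat_in_itvoo[q]|//] := ltgtP (s n) (s' n).
- by rewrite in_itv /= => /andP[sq]; rewrite ltNge ltW// -E.
- by rewrite in_itv /= => /andP[sq]; rewrite ltNge ltW// E.
Qed.

(** Since pairs of binary sequences inject into [A], it contains continuum many disjoint sets of
    size continuum, and a countable [B] must miss one of them. *)
Lemma continuum_setD T (A B : set T) :
  continuum #<= A -> countable B -> continuum #<= A `\` B.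
Proof.
move=> /card_setT_leP[f f_inj fA] B_countable.
have /card_setT_leP[p p_inj _] :
    [set: (nat -> bool) * (nat -> bool)] #<= continuum.
  apply: card_le_trans (predicates_le_continuum (nat + nat)%type).
  apply/card_setT_leP; exists (fun x c => match c with
    inl n => x.1 n | inr n => x.2 n end) => // -[s t] [s' t'] /= E.
  by congr (_, _); apply: funext => n;
    [have := congr1 (@^~ (inl n)) E | have := congr1 (@^~ (inr n)) E].
have [t tB] : exists t, forall s, ~ B (f (p (t, s))).
  apply: contrapT => /forallNP BN.
  have /choice[s sB] t : exists s, B (f (p (t, s))).
    by apply: contrapT => /forallNP; exact: BN.
  apply: continuum_uncountable; apply: sub_countable B_countable.
  apply/card_setT_leP; exists (fun t => f (p (t, s t))) => [t u|t].
    by move=> /f_inj /p_inj [].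
  exact: sB.
apply/card_setT_leP; exists (fun s => f (p (t, s))) => [u v|s].
  by move=> /f_inj /p_inj [].
by split; [exact: fA | exact: tB].
Qed.

Lemma countable_setU T (A B : set T) :
  countable A -> countable B -> countable (A `|` B).
Proof.
move=> cA cB; pose F b := if b then A else B.
apply: (@sub_countable _ _ _ (\bigcup_b F b)); last first.
  by apply: bigcup_countable => // -[].
by apply: subset_card_le => x [Ax|Bx]; [exists true|exists false].
Qed.

(** * Left limits of sets of reals and Cantor schemes *)

Section RealSets.
Variable R : realType.
Implicit Types (X D : set R) (p q : R).

Definition part X p q : set R := [set x | X x /\ p < x < q].

(** If nothing splits, every rational between [p] and [q] leaves a countable piece on one side.
    Discarding these countably many pieces leaves at most one point, since a rational between two
    remaining points would split. *)
Lemma uncountable_split X p q : ~ countable (part X p q) ->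
  exists m, [/\ p < m, m < q, ~ countable (part X p m) &
                ~ countable (part X m q)].
Proof.
move=> Xpq; apply: contrapT => noSplit; apply: Xpq.
pose L := [set r : rat | countable (part X p (ratr r))].
pose U := [set r : rat | countable (part X (ratr r) q)].
pose E := (\bigcup_(r in L) (part X p (ratr r))) `|`
          (\bigcup_(r in U) (part X (ratr r) q)).
have E_countable : countable E.
  by apply: countable_setU; apply: bigcup_countable.
suff : countable ((part X p q) `\` E).
  move=> /(fun h => countable_setU h E_countable); apply: sub_countable.
  by apply: subset_card_le => x Xx; have [Ex|nEx] := pselect (E x); [right|left].
have rest x (r : rat) : p < ratr r -> ratr r < q -> (part X p q) x -> ~ E x ->
    (L r -> ratr r <= x) /\ (U r -> x <= ratr r).
  move=> pr rq [Xx /andP[px xq]] Ex; split=> [Lr|Ur].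
    rewrite leNgt; apply/negP => xr; apply: Ex; left; exists r => //.
    by split; rewrite ?px.
  rewrite leNgt; apply/negP => xr; apply: Ex; right; exists r => //.
  by split; rewrite ?xq ?andbT.
have uniq x y : x < y -> (part X p q) x -> ~ E x -> (part X p q) y -> ~ E y -> False.
  move=> /rat_in_itvoo[r]; rewrite in_itv /= => /andP[xr ry] Xx Ex Xy Ey.
  have pr : p < ratr r.
    by apply: lt_trans xr; have [_ /andP[]] := Xx.
  have rq : ratr r < q.
    by apply: lt_trans ry _; have [_ /andP[]] := Xy.
  have [Lx _] := rest x r pr rq Xx Ex; have [_ Uy] := rest y r pr rq Xy Ey.
  apply: noSplit; exists (ratr r); split=> //.
    by move=> /Lx; rewrite leNgt xr.
  by move=> /Uy; rewrite leNgt ry.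
(* A constant map is injective on a set with at most one point. *)
apply: (@countable_rat _ _ (fun=> 0%R)) => x y [Xx Ex] [Xy Ey] _.
have [xy|yx|//] := ltgtP x y; first by case: (uniq x y).
by case: (uniq y x).
Qed.

(* The second clause excludes the points above all of [D], which would not cut
   [D] into two non-empty parts. *)
Definition left_limits D : set R :=
  [set z | (forall w, w < z -> exists2 x, D x & w < x < z) /\
           (exists2 x, D x & z <= x)].

Lemma uncountable_neq0 T (A : set T) : ~ countable A -> A !=set0.
Proof. by move=> AN; apply/set0P; apply: contra_notN AN => /eqP->. Qed.

Lemma uncountable_part X : ~ countable X ->
  exists p q, ~ countable (part X p q).
Proof.
move=> X_unc; apply: contrapT => none; apply: X_unc.
apply: (@sub_countable _ _ _
  (\bigcup_(r : rat * rat) part X (ratr r.1) (ratr r.2))); last first.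
  apply: bigcup_countable => // r _; apply: contrapT => rX.
  by apply: none; exists (ratr r.1), (ratr r.2).
apply: subset_card_le => x Xx.
have /rat_in_itvoo[a] : (x - 1 < x)%R by rewrite ltrBlDr ltrDl.
have /rat_in_itvoo[b] : (x < x + 1)%R by rewrite ltrDl.
rewrite !in_itv /= => /andP[xb _] /andP[_ ax].
by exists (a, b) => //; split; rewrite // ax.
Qed.

Section CantorScheme.
Variables (X : set R) (P : R -> R -> Prop).
Hypothesis P_part : forall p q, P p q -> part X p q !=set0.
Hypothesis P_split : forall p q, P p q ->
  exists m, [/\ p < m, m < q, P p m & P m q].

(** The point [x] is placed to the left of both subintervals, so that the points met along a branch
    approach its limit strictly from the left. The premise sits behind the existentials so that
    choice yields total functions. *)
Lemma cantor_step (I : R * R) : exists (x : R) (J : bool -> R * R),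
  P I.1 I.2 ->
  [/\ X x, forall b, I.1 < x < (J b).1, forall b, (J b).2 <= I.2,
      forall b, P (J b).1 (J b).2 & (J false).2 <= (J true).1].
Proof.
have [I_P|?] := pselect (P I.1 I.2); last by exists 0%R, (fun=> I).
have [m [pm mq /P_split[m0 [pm0 m0m pU0 U0m]] U1]] := P_split I_P.
have [m1 [mm1 m1q _ U1m]] := P_split U1.
have [x [Xx /andP[px xm]]] := P_part pU0.
exists x, (fun b => if b then (m1, I.2) else (m0, m)) => _; split => //=.
- case=> //=; rewrite px //=; first exact: lt_trans (lt_trans xm m0m) mm1.
- by case=> //=; exact: ltW.
- by case.
- exact: ltW.
Qed.

(** A branch [t] gives [z t], the supremum of its left endpoints. Points of [X] lie between
    consecutive left endpoints, so [z t] is a left limit; branches that part at stage [n] continue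
    in separated intervals, so [z] is injective. *)
Lemma cantor_scheme p0 q0 : P p0 q0 ->
  exists2 s : nat -> R, range s `<=` X & continuum #<= left_limits (range s).
Proof.
(* The tree grows in the left half only; the right half supplies [top], a point of [X] above all the
   limits. *)
move=> /P_split[m [_ _ I0_P /P_part[top [Xtop /andP[mtop _]]]]].
have /choice[x /choice[J step]] := cantor_step.
pose node l : R * R := foldl J (p0, m) l.
have node_P l : P (node l).1 (node l).2.
  elim/last_ind: l => // l b IH; rewrite /node foldl_rcons.
  by have [_ _ _ + _] := step _ IH; exact.
have nodeP l := step _ (node_P l).
(* The code of [None], like every number that codes nothing, is sent to [top]. *)
pose s n := if unpickle n is Some (Some l) then x (node l) else top.
exists s.
  move=> _ [n _ <-]; rewrite /s; case: unpickle => [[l|]|] //.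
  by have [] := nodeP l.
have s_top : range s top.
  by exists (pickle (None : option (seq bool))) => //; rewrite /s pickleK.
have s_node l : range s (x (node l)).
  by exists (pickle (Some l)) => //; rewrite /s pickleK.
pose lo t n := (node (mkseq t n)).1.
pose hi t n := (node (mkseq t n)).2.
have nodeS t n : node (mkseq t n.+1) = J (node (mkseq t n)) (t n).
  by rewrite mkseqS /node foldl_rcons.
have lo_x t n : lo t n < x (node (mkseq t n)) < lo t n.+1.
  by rewrite /lo nodeS; have [_ + _ _ _] := nodeP (mkseq t n); exact.
have loS t n : lo t n < lo t n.+1 by have /andP[] := lo_x t n; exact: lt_trans.
have hiS t n : hi t n.+1 <= hi t n.
  by rewrite /hi nodeS; have [_ _ + _ _] := nodeP (mkseq t n); exact.
have lo_hi t n k : lo t n < hi t k.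
  have lo_mono i j : lo t i <= lo t (i + j).
    by elim: j => [|j IH]; rewrite ?addn0// addnS (le_trans IH)// ltW.
  have hi_mono i j : hi t (i + j) <= hi t i.
    by elim: j => [|j IH]; rewrite ?addn0// addnS (le_trans (hiS _ _)).
  apply: le_lt_trans (lo_mono n k) _; apply: lt_le_trans (hi_mono k n).
  rewrite (addnC k); have [y [_ /andP[]]] := P_part (node_P (mkseq t (n + k))).
  exact: lt_trans.
pose z t := sup (range (lo t)).
have lo_z t n : lo t n < z t.
  apply: lt_le_trans (loS t n) _; apply: ub_le_sup; last by exists n.+1.
  by exists (hi t 0) => _ [k _ <-]; exact/ltW.
have z_hi t n : z t <= hi t n.
  apply: ge_sup; first by exists (lo t 0); exists 0.
  by move=> _ [k _ <-]; exact/ltW.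
have z_lt t u n : mkseq t n = mkseq u n -> t n = false -> u n = true -> z t < z u.
  move=> tu tn un; apply: le_lt_trans (z_hi t n.+1) _.
  apply: le_lt_trans (lo_z u n.+1).
  by rewrite /hi /lo !nodeS tn un tu; have [] := nodeP (mkseq u n).
apply/card_setT_leP; exists z => [t u tu|t].
  apply: funext => n; elim/ltn_ind: n => n IH.
  have {IH}tun : mkseq t n = mkseq u n.
    by apply/eq_in_map => i; rewrite mem_iota => /IH.
  case tn: (t n); case un: (u n) => //.
    by have := z_lt u t n (esym tun) un tn; rewrite tu ltxx.
  by have := z_lt t u n tun tn un; rewrite tu ltxx.
split=> [w wz|]; last first.
  by exists top => //; rewrite (le_trans (z_hi t 0))//= ltW.
have [n wn] : exists n, w < lo t n.
  apply: contrapT => /forallNP wN; move: wz; rewrite ltNge => /negP; apply.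
  apply: ge_sup; first by exists (lo t 0); exists 0.
  by move=> _ [n _ <-]; rewrite leNgt; apply/negP/wN.
exists (x (node (mkseq t n))) => //; have /andP[lx xl] := lo_x t n.
by rewrite (lt_trans wn lx) (lt_trans xl).
Qed.


End CantorScheme.

Lemma uncountable_left_limits X : ~ countable X ->
  exists2 s : nat -> R, range s `<=` X & continuum #<= left_limits (range s).
Proof.
move=> /uncountable_part[p [q]].
apply: (@cantor_scheme X (fun p q => ~ countable (part X p q))) => {}p {}q.
  exact: uncountable_neq0.
exact: uncountable_split.
Qed.

(** * A Bernstein-like set of irrationals *)

Lemma continuum_le_irrational : continuum #<= @irrational R.
Proof.
(* The scheme over all nondegenerate intervals yields continuum many reals, of which only countably
   many are rational. *)
have [|p q pq|s _ s_cont] :=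
    @cantor_scheme setT (fun p q => p < q) _ _ 0%R 1%R ltr01.
- by move=> p q pq; exists ((p + q) / 2)%R; split; rewrite // !midf_lt.
- by exists ((p + q) / 2)%R; rewrite !midf_lt.
rewrite /irrational -setTD; apply: continuum_setD.
  by apply: card_le_trans s_cont _; exact: card_leT.
exact: sub_countable (card_image_le _ _) _.
Qed.

(** Quantifying over sequences instead of arbitrary sets leaves only continuum many conditions, few
    enough for a transversal. *)
Definition bernstein_like (K : set R) := forall s : nat -> R,
  continuum #<= left_limits (range s) ->
  continuum #<= left_limits (range s) `\` K.

Lemma exists_bernstein_like : exists K : set R,
  [/\ K `<=` @irrational R, ~ countable K & bernstein_like K].
Proof.
(* The parameter [t] of the index [(s, t, b)] makes room for continuum many
   points: those with [b = false] form [K], those with [b = true] are kept out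
   of [K]. *)
pose large (s : nat -> R) := continuum #<= left_limits (range s).
pose S (i : (nat -> R) * (nat -> bool) * bool) : set R :=
  if i.2 && large i.1.1 then left_limits (range i.1.1) else @irrational R.
have [i|z z_inj zS] := @injective_transversal _ _ S.
  apply: card_le_trans (sequences_le_continuum R) _; rewrite /S.
  by case: ifP => [/andP[]//|_]; exact: continuum_le_irrational.
pose K := range (fun t => z (fun=> 0%R, t, false)).
exists K; split.
- by move=> _ [t _ <-]; exact: (zS (_, t, false)).
- move=> K_countable; apply: continuum_uncountable.
  apply: sub_countable K_countable; apply/card_setT_leP.
  exists (fun t => z (fun=> 0%R, t, false)) => [t u /z_inj[]//|t].
  by exists t.
- move=> s s_large; apply/card_setT_leP.
  exists (fun t => z (s, t, true)) => [t u /z_inj[]//|t]; split.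
    by have := zS (s, t, true); rewrite /S /= /large s_large.
  by move=> [u _ /z_inj].
Qed.

End RealSets.

(** * Monotone maps into a Bernstein-like set *)

Section CountableImages.
Variables (R : realType) (K : set R).
Hypothesis K_bernstein : bernstein_like K.

Lemma few_gaps_countable_range d (M : orderType d) (g : M -> R) :
  {homo g : x y / x <= y} -> range g `<=` K -> ~ (continuum #<= gaps M) ->
  countable (range g).
Proof.
move=> g_homo gK few_gaps; apply: contrapT => /uncountable_left_limits[s sg].
move=> /K_bernstein; set Z := left_limits _ `\` K => Z_large; apply: few_gaps.
have g_lt x y : g x < g y -> x < y.
  by rewrite !ltNge; apply: contraNN => /g_homo.
have Z_left z w : Z z -> w < z -> exists x, w < g x < z.
  by move=> [[zl _] _] /zl[_ /sg[x _ <-]]; exists x.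
pose cut z := [set x | g x < z].
pose bad := [set z | Z z /\ exists2 x, ~ cut z x & forall y, ~ cut z y -> x <= y].
have bad_countable : countable bad.
  have /choice[q qP] z : exists q : rat, bad z ->
      exists2 x, z < ratr q < g x & forall y, ~ cut z y -> x <= y.
    have [[[_ zK] [x /negP]]|nbad] := pselect (bad z); last by exists 0%R.
    rewrite -leNgt le_eqVlt => /predU1P[zx|].
      by case: zK; rewrite zx; apply: gK; exists x.
    by move=> /rat_in_itvoo[q]; rewrite in_itv /= => zqx xmin;
       exists q => _; exists x.
  have q_neq z w : z < w -> bad z -> bad w -> q z <> q w.
    move=> zw zbad wbad zwq; have [x /andP[_ qx] xmin] := qP z zbad.
    have [x' /andP[wq _] _] := qP w wbad; have [Zw _] := wbad.
    have [y /andP[zy yw]] := Z_left w z Zw zw.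
    have /xmin/g_homo xy : ~ cut z y by apply/negP; rewrite -leNgt ltW.
    have := lt_trans qx (le_lt_trans xy yw).
    by rewrite zwq ltNge ltW.
  apply: (@countable_rat _ _ q) => z w zbad wbad zw.
  have [zltw|wltz|//] := ltgtP z w; first by case: (q_neq z w).
  by case: (q_neq w z).
apply: card_le_trans (continuum_setD Z_large bad_countable) _.
have cut_lt z w : Z w -> z < w -> cut z <> cut w.
  move=> Zw zw E; have [x /andP[zx xw]] := Z_left w z Zw zw.
  by have : cut w x by []; rewrite -E /cut /= ltNge ltW.
have cut_inj : {in Z `\` bad &, injective cut}.
  move=> z w; rewrite !inE => -[Zz _] [Zw _] E.
  have [zltw|wltz|//] := ltgtP z w; first by case: (cut_lt z w).
  by case: (cut_lt w z).
rewrite -(card_le_eql (inj_card_eq cut_inj)).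
apply: subset_card_le => _ [z [Zz zgood] <-]; split.
- by have [|x /andP[]] := Z_left z (z - 1)%R Zz; [rewrite ltrBlDr ltrDl|exists x].
- by move=> x y /g_homo xy; exact: le_lt_trans.
- move=> [x xz xmax]; have [y /andP[/g_lt xy yz]] := Z_left z (g x) Zz xz.
  by have := xmax y yz; rewrite leNgt xy.
- by have [[_ [_ /sg[x _ <-] zx]] _] := Zz; exists x; apply/negP; rewrite -leNgt.
- by move=> xmin; apply: zgood.
Qed.

(** * Slabs of the product and induction on the number of factors *)

Section Colex.
Variables (m : nat) (d : 'I_m -> Order.disp_t) (L : forall i, orderType (d i)).
Implicit Types x y : colex_prod L.

(** The slab is a copy of the product of the first [j] factors: a single point for [j = 0],
    everything for [j = m]. Induction on [j] thus avoids changing the index type of the product. *)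
Definition slab (j : nat) x : set (colex_prod L) :=
  [set y | forall i : 'I_m, (j <= i)%N -> y i = x i].

Definition update x (i : 'I_m) (k : L i) : colex_prod L :=
  [ffun j => eqtype.dfwith x k j].

Lemma update_in x i (k : L i) : update x k i = k.
Proof. by rewrite ffunE dfwith_in. Qed.

Lemma update_out x i (k : L i) j : i != j -> update x k j = x j.
Proof. by move=> ij; rewrite ffunE dfwith_out. Qed.

Lemma slab_update x (i : 'I_m) y :
  slab i.+1 x y -> slab i (update x (y i)) y.
Proof.
move=> xy j ij; have [<-|ne] := eqVneq i j; first by rewrite update_in.
by rewrite update_out// xy// ltn_neqAle ij andbT.
Qed.

Arguments slab_update : clear implicits.

Lemma slab_lt x (i : 'I_m) (k l : L i) y z : k < l ->
  slab i (update x k) y -> slab i (update x l) z -> y < z.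
Proof.
move=> kl yk zl; apply/colex_ltP; exists i; first by rewrite yk// zl// !update_in.
move=> j ij; rewrite yk ?zl ?(ltnW ij)//.
by rewrite !update_out// neq_ltn ij.
Qed.

Lemma colex_countable_range (f : colex_prod L -> R) :
  {homo f : x y / x <= y} -> range f `<=` K ->
  (forall i, countable [set: L i] \/ ~ (continuum #<= gaps (L i))) ->
  countable (range f).
Proof.
move=> f_homo fK L_small.
have slab_countable j : (j <= m)%N -> forall x, countable (f @` slab j x).
  elim: j => [_ x|j IH jm x].
    apply: (@sub_countable _ _ _ [set f x]); last exact: countable1.
    apply: subset_card_le => _ [y yx <-]; congr f.
    by apply/ffunP => i; exact: yx.
  pose i := Ordinal jm; have {}IH y : countable (f @` slab i y) by exact/IH/ltnW.
  have [Li|Li] := L_small i.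
    apply: (@sub_countable _ _ _ (\bigcup_(k : L i) f @` slab i (update x k))).
      apply: subset_card_le => _ [y xy <-]; exists (y i) => //; exists y => //.
      exact: slab_update.
    by apply: bigcup_countable.
  (* The slabs over distinct [k] are mapped to essentially disjoint intervals of
     the reals, so [f] is constant on all but countably many of them. *)
  pose D := [set k : L i | exists y z, [/\ slab i (update x k) y,
    slab i (update x k) z & f y < f z]].
  have D_countable : countable D.
    have /choice[q qP] (k : L i) : exists q : rat, D k -> exists y z,
        [/\ slab i (update x k) y, slab i (update x k) z & f y < ratr q < f z].
      have [[y [z [ky kz]]]|nD] := pselect (D k); last by exists 0%R.
      move=> /rat_in_itvoo[q]; rewrite in_itv /= => yqz.
      by exists q => _; exists y, z.
    have q_neq k l : k < l -> D k -> D l -> q k <> q l.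
      move=> kl /qP[_ [y [_ ky /andP[_ qy]]]] /qP[z [_ [lz _ /andP[zq _]]]] E.
      have /ltW/f_homo := slab_lt kl ky lz.
      by rewrite leNgt (lt_trans zq)// -E.
    apply: (@countable_rat _ _ q) => k l kD lD E.
    have [kl|lk|//] := ltgtP k l; first by case: (q_neq k l).
    by case: (q_neq l k).
  (* One representative per slab gives a monotone map on [L i]; off [D] its value is the only value
     of [f] on the slab. *)
  have range_countable : countable (range (f \o @update x i)).
    apply: few_gaps_countable_range => // [k l|_ [k _ <-]]; last first.
      by apply: fK; exists (update x k).
    rewrite le_eqVlt => /predU1P[->//|kl]; apply: f_homo; apply: ltW.
    exact: (slab_lt kl).
  apply: (@sub_countable _ _ _ ((\bigcup_(k in D) f @` slab i (update x k)) `|`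
      range (f \o @update x i))); last first.
    by apply: countable_setU => //; exact: bigcup_countable.
  apply: subset_card_le => _ [y /(slab_update x i) xy <-].
  have [Dy|nDy] := pselect (D (y i)); first by left; exists (y i) => //; exists y.
  right; exists (y i) => //=; apply/eqP/negPn/negP.
  rewrite neq_lt => /orP[] fy; apply: nDy.
    by exists (update x (y i)), y.
  by exists y, (update x (y i)).
have [->|/set0P[_ [x _ _]]] := eqVneq (range f) set0; first exact: countable0.
apply: sub_countable (slab_countable m (leqnn m) x).
apply: subset_card_le => _ [y _ <-]; exists y => // i.
by rewrite leqNgt ltn_ord.
Qed.

End Colex.
End CountableImages.

(** * Countable products, gaps of orders embedded in the reals, and the conclusion *)

Lemma countable_colex_prod m (d : 'I_m -> Order.disp_t)
    (L : forall i, orderType (d i)) :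
  (forall i, countable [set: L i]) -> countable [set: colex_prod L].
Proof.
move=> cL; have code i : exists f : L i -> nat, injective f.
  by have /card_setT_leP[f] := cL i; exists f.
pose f i := sval (cid (code i)).
have f_inj i : injective (f i) := svalP (cid (code i)).
apply: (@sub_countable _ _ _ [set: {ffun 'I_m -> nat}]) => //.
apply/card_setT_leP; exists (fun x : colex_prod L => [ffun i => f i (x i)]) => //.
move=> x y /ffunP xy; apply/ffunP => i; apply: f_inj.
by have := xy i; rewrite !ffunE.
Qed.

(** Take for [c] the supremum of the image of [A]. It is not attained on [A], which has no maximum,
    nor outside [A], where a point over [c] would be a minimum of the complement. *)
Lemma gapP (R : realType) d (M : orderType d) (f : M -> R) (A : set M) :
  is_embedding f -> is_gap A ->
  exists2 c, ~ range f c & A = [set x | f x < c].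
Proof.
move=> [f_homo f_inj] [[a Aa] Adown nomax [b Ab] nomin].
have f_lt x y : f x < f y -> x < y.
  by rewrite !ltNge; apply: contraNN => /f_homo.
have A_lt x y : A x -> ~ A y -> x < y.
  by move=> Ax Ay; rewrite ltNge; apply/negP => /Adown /(_ Ax).
have f_strict x y : x < y -> f x < f y.
  move=> xy; rewrite lt_neqAle f_homo ?ltW// andbT.
  by apply: contraTneq xy => /f_inj ->; rewrite ltxx.
have ubA y : ~ A y -> ubound (f @` A) (f y).
  by move=> Ay _ [x Ax <-]; apply/f_homo/ltW/A_lt.
pose c := sup (f @` A).
have in_lt x : A x -> f x < c.
  move=> Ax; have [y Ay xy] : exists2 y, A y & x < y.
    apply: contrapT => none; apply: nomax; exists x => // y Ay.
    by rewrite leNgt; apply/negP => xy; apply: none; exists y.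
  apply: lt_le_trans (f_strict _ _ xy) _; apply: ub_le_sup; last by exists y.
  by exists (f b); exact: ubA.
have out_ge x : ~ A x -> c <= f x.
  by move=> Ax; apply: ge_sup; [exists (f a), a | exact: ubA].
exists c.
  move=> [x _ xc]; apply: nomin; exists x => [/in_lt|y Ay]; first by rewrite xc ltxx.
  by rewrite leNgt; apply/negP => /f_strict; rewrite xc ltNge out_ge.
apply/seteqP; split=> x /=; first exact: in_lt.
by move=> xc; apply: contrapT => /out_ge; rewrite leNgt xc.
Qed.

Lemma lt_continuumN T (A : set T) : lt_continuum A -> ~ (continuum #<= A).
Proof. by move=> [Ac /negP nAc] cA; apply: nAc; rewrite card_eq_le Ac. Qed.

Lemma countable_lt_continuum T (A : set T) : countable A -> lt_continuum A.
Proof.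
move=> cA; split.
  apply: card_le_trans cA _; apply: card_le_trans (predicates_le_continuum nat).
  apply/card_setT_leP; exists (fun m n => m == n) => // m n.
  by move=> /(congr1 (@^~ n)); rewrite eqxx => /eqP.
apply/negP; rewrite card_eq_le => /andP[_ /sub_countable/(_ cA)].
exact: continuum_uncountable.
Qed.

Lemma is_embedding_val d (T : orderType d) (A : set T) :
  is_embedding (val : A -> T).
Proof. by split=> [x y|]; [rewrite leEsub | exact: val_inj]. Qed.

Lemma irrational_like_irrational (R : realType) :
  irrational_like R (@irrational R).
Proof.
split; first by exists id; split.
apply: countable_lt_continuum.
pose cut (c : R) := [set x : @irrational R | val x < c].
(* A gap is cut out by a real that is not irrational, so there are at most as many gaps as
   rationals. *)
apply: (@sub_countable _ _ _ (cut @` @rational R)).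
  apply: subset_card_le => A /(gapP (is_embedding_val _))[c c_out ->].
  exists c => //; apply: contrapT => c_irr; apply: c_out.
  by exists (SigSub (mem_set (c_irr : @irrational R c))).
apply: sub_countable (card_image_le _ _) _.
exact: sub_countable (card_image_le _ _) _.
Qed.

Lemma irrational_like_real (R : realType) : irrational_like R R.
Proof.
split; first by exists val; exact: is_embedding_val.
apply: countable_lt_continuum.
suff -> : gaps R = set0 by [].
apply/seteqP; split=> // A /(@gapP R _ R id)[|c c_out _]; first by split.
by case: c_out; exists c.
Qed.

Lemma uncountable_colex_not_strongly_surjective (R : realType) m
    (d : 'I_m -> Order.disp_t) (L : forall i, orderType (d i)) :
  (forall i, [set: L i] !=set0) ->
  (forall i, countable [set: L i] \/ irrational_like R (L i)) ->
  ~ countable [set: colex_prod L] -> ~ strongly_surjective (colex_prod L).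
Proof.
move=> L_neq0 L_kind L_unc L_surj.
have [i Li_unc] : exists i, ~ countable [set: L i].
  by apply/existsNP => /countable_colex_prod.
have [//|[[h [h_homo h_inj]] _]] := L_kind i.
have [K [K_irr K_unc K_bernstein]] := exists_bernstein_like R.
pose base : colex_prod L := [ffun j => sval (cid (L_neq0 j))].
pose incl (k : K) : @irrational R := SigSub (mem_set (K_irr _ (set_valP k))).
(* Only coordinate [i] varies, so the order on the image is that of [L i]. *)
pose e (k : K) := update base (h (incl k)).
have e_inj : injective e.
  move=> k l /(congr1 (fun x : colex_prod L => x i)).
  by rewrite !update_in => /h_inj /(congr1 val) /= /val_inj.
have e_homo : {homo e : k l / k <= l}.
  move=> k l; rewrite le_eqVlt => /predU1P[->//|kl]; apply: ltW.
  apply: (@slab_lt _ _ _ base i (h (incl k)) (h (incl l))) => //.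
  rewrite lt_neqAle h_homo ?andbT; last by rewrite leEsub ltW// -ltEsub.
  by apply: contraTneq kl => /h_inj /(congr1 val) /= /val_inj ->; rewrite ltxx.
have [x Kx] := uncountable_neq0 K_unc.
have [||f [f_homo f_surj]] := L_surj _ K.
- by exists (SigSub (mem_set Kx)).
- by exists e.
apply: K_unc; have f_range : range (val \o f) = K.
  apply/seteqP; split=> [_ [y _ <-]|y Ky]; first exact: set_valP.
  by have [w fw] := f_surj (SigSub (mem_set Ky)); exists w => //=; rewrite fw.
rewrite -f_range; apply: (@colex_countable_range _ _ K_bernstein).
- by move=> y z /f_homo; rewrite leEsub.
- by rewrite f_range.
- move=> j; have [|[_ /lt_continuumN]] := L_kind j; first by left.
  by right.
Qed.

Theorem theorem5p8 (R : realType) :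
  (forall (n : nat) (d : 'I_n.+1 -> Order.disp_t)
          (L : forall i, orderType (d i)),
     (forall i, [set: L i] !=set0) ->
     (forall i, countable [set: L i] \/ irrational_like R (L i)) ->
     ~ countable [set: colex_prod L] ->
     ~ strongly_surjective (colex_prod L)) /\
  irrational_like R (@irrational R) /\
  irrational_like R R.
Proof.
split=> [n d L|]; first exact: uncountable_colex_not_strongly_surjective.
by split; [exact: irrational_like_irrational | exact: irrational_like_real].
Qed.
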